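(* Let $n\ge2$, let $\Omega\subset\mathbb{R}^n$ be an open set and let $f,g$ be positive continuous functions on $\Omega$ with $\int_\Omega f\,dx<\infty$. Let $1\le p\le q<\infty$, $\delta\in(0,1)$ and $\tau\in(0,\infty)$. Assume that for every ball $B\subset\subset\Omega$ there exists a constant $C=C(\Omega,B,f,g,p,q,\delta,\tau)$ such that \[ \Big(\int_A f(x)\,dx\Big)^{p/q}\le C\inf_u\int_\Omega g_u^\tau(x)g(x)\,dx \] for every admissible set $A\subset\Omega$ with $A\cap B=\emptyset$, where the infimum is over all $u\in C(\Omega)$ with $u|_A\ge1$ and $u|_B=0$. Then for every ball $B\subset\subset\Omega$ there is a constant $C$ such that for every $u\in C(\Omega)$ with $u|_B=0$, \[ \Big(\int_\Omega|u(x)|^qf(x)\,dx\Big)^{1/q}\le C\Big(\int_\Omega g_u^\tau(x)g(x)\,dx\Big)^{1/p}. \]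
   Context: $g_u^\tau(x)=\int_{\Omega\cap B(x,\tau d(x,\partial\Omega))}\frac{|u(x)-u(y)|^p}{|x-y|^{n+p\delta}}\,dy$ for $u\in C(\Omega)$. A set $A$ is an admissible subset of $\Omega$ if $A\subset\Omega$ is open and $\partial A\cap\Omega$ is a smooth submanifold. $B\subset\subset\Omega$ means $d(B,\partial\Omega)>0$. *)

(* Defs.v *)
From HB Require Import structures.
From mathcomp Require Import all_boot all_order all_algebra.
From mathcomp Require Import all_classical all_reals all_analysis.
Set Implicit Arguments. Unset Strict Implicit. Unset Printing Implicit Defensive.
Import Order.TTheory GRing.Theory Num.Theory.
Import numFieldNormedType.Exports.
Local Open Scope classical_set_scope.
Local Open Scope ring_scope.

Section Defs.
Context {R : realType} {n : nat}.
Local Notation V := 'rV[R]_n.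

(* Euclidean norm on R^n (the library norm on rows is the sup norm). *)
Definition enorm (v : V) : R := Num.sqrt (\sum_(i < n) v ord0 i ^+ 2).

Definition eball (c : V) (r : R) : set V := [set y | enorm (y - c) < r].

Definition is_eball (B : set V) : Prop := exists c r, 0 < r /\ B = eball c r.

Definition bdry (S : set V) : set V := closure S `\` interior S.

(* Euclidean distance from a point to a set (+oo for the empty set) *)
Definition edist (x : V) (S : set V) : \bar R :=
  ereal_inf [set (enorm (x - y))%:E | y in S].

Definition setdist (A S : set V) : \bar R :=
  ereal_inf [set e | exists a y, A a /\ S y /\ e = (enorm (a - y))%:E].

Definition cpt_in (B Om : set V) : Prop :=
  B `<=` Om /\ (0 < setdist B (bdry Om))%E.

Fixpoint ider (c : nat) (vs : seq V) (F : V -> 'rV[R]_c) : V -> 'rV[R]_c :=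
  match vs with
  | [::] => F
  | v :: vs' => ider vs' ('D_v F)
  end.

Definition smooth_on_set (c : nat) (U : set V) (F : V -> 'rV[R]_c) : Prop :=
  forall vs : seq V,
    {within U, continuous (ider vs F)} /\
    (forall v x, U x -> derivable (ider vs F) x v).

(* smooth embedded submanifold of R^n (of some fixed codimension c),
   given locally as the zero set of a smooth submersion *)
Definition smooth_submanifold (M : set V) : Prop :=
  exists c : nat, forall x, M x ->
    exists (U : set V) (F : V -> 'rV[R]_c),
      [/\ open U, U x, smooth_on_set U F,
          (forall y, U y -> M y -> forall w : 'rV[R]_c, exists v : V, 'D_v F y = w)
        & (forall y, U y -> (M y <-> F y = 0))].

Definition admissible (Om A : set V) : Prop :=
  [/\ A `<=` Om, open A & smooth_submanifold (bdry A `&` Om)].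

End Defs.

Fixpoint iint {R : realType} (k : nat) (F : seq R -> \bar R) : \bar R :=
  match k with
  | 0 => F [::]
  | k'.+1 => (\int[@lebesgue_measure R]_x iint k' (fun s => F (x :: s)))%E
  end.

(* Lebesgue integral over D ⊂ R^n (of a nonnegative Borel function, via Tonelli) *)
Definition lint {R : realType} {n : nat} (D : set 'rV[R]_n)
  (h : 'rV[R]_n -> \bar R) : \bar R :=
  iint n (fun s => let x := \row_(i < n) nth 0 s i in
                   if `[< D x >] then h x else 0%E).

Definition gfun {R : realType} {n : nat} (Om : set 'rV[R]_n) (p delta tau : R)
  (u : 'rV[R]_n -> R) (x : 'rV[R]_n) : \bar R :=
  lint [set y | Om y /\ ((enorm (x - y))%:E < tau%:E * edist x (bdry Om))%E]
    (fun y => ((`|u x - u y| `^ p) / (enorm (x - y) `^ (n%:R + p * delta)))%:E).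

(* Main.v *)
Require Import Defs.
From HB Require Import structures.
From mathcomp Require Import all_boot all_order all_algebra.
From mathcomp Require Import all_classical all_reals all_analysis.
From mathcomp Require Import measurable_realfun ring lra.
Import Order.TTheory GRing.Theory Num.Theory.
Import numFieldNormedType.Exports.
Local Open Scope classical_set_scope.
Local Open Scope ring_scope.

(** Maz'ya's truncation method. For [s > 0] the truncation
    [u_s = (min(|u|, 2s) - min(|u|, s)) / s] is at least 1 on the open set
    [E_s = {|u| > 2s}] and vanishes on [B]. The set [E_s] need not be admissible,
    but it contains unions of pairwise distant balls, one in each dyadic cube
    inside [E_s]; such a union is admissible, and for a fine mesh it carries a
    fixed proportion of the integral of [f] over [E_s]. Hence
    [c * int_{E_s} f <= (C * int g_{u_s} g)^(q/p)]. Now sum over the powers [s]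
    of 2: the layers [s u_s] telescope, so [sum_s s^p g_{u_s} <= g_u] pointwise
    because [p >= 1], and [sum_s t_s^(q/p) <= (sum_s t_s)^(q/p)] because [p <= q].
    On the side of [g_u] only monotonicity, superadditivity and homogeneity of
    lower integrals are used, so that no measurability of [g_u] is needed. *)

(** * Lower integrals of possibly non-measurable functions *)

(** The integral of a nonnegative function is a supremum over the simple functions below it,
    measurable or not, and a simple function below [f] is also below [g]. *)
Lemma ge0_le_lower_integral d (T : measurableType d) (R : realType)
  (mu : {measure set T -> \bar R}) (f g : T -> \bar R) :
  (forall x, 0 <= f x)%E -> (forall x, f x <= g x)%E ->
  (\int[mu]_x f x <= \int[mu]_x g x)%E.
Proof.
move=> f0 fg; have g0 x : (0 <= g x)%E by apply: le_trans (fg x).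
rewrite !ge0_integralTE//; apply: le_ereal_sup => _ [h hf <-].
by exists h => // x; apply: le_trans (hf x) (fg x).
Qed.

Lemma ge0_lower_integralZ d (T : measurableType d) (R : realType)
  (mu : {measure set T -> \bar R}) (c : R) (f : T -> \bar R) :
  0 <= c -> (forall x, 0 <= f x)%E ->
  (c%:E * \int[mu]_x f x <= \int[mu]_x (c%:E * f x))%E.
Proof.
move=> c0 f0; have cf0 x : (0 <= c%:E * f x)%E by rewrite mule_ge0 ?lee_fin.
rewrite (ge0_integralTE _ f0) (ge0_integralTE _ cf0).
have [->|cn0] := eqVneq c 0.
  rewrite mul0e; apply: ereal_sup_ubound; exists nnsfun0 => /=.
    by move=> x; rewrite mul0e.
  exact: sintegral0.
have cp : 0 < c by rewrite lt_neqAle eq_sym cn0.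
rewrite muleC -lee_pdivlMr//; apply: ge_ereal_sup => _ [h hf <-].
rewrite lee_pdivlMr// muleC -sintegralrM; apply: ereal_sup_ubound.
exists (scale_nnsfun h c0) => // x /=.
by rewrite EFinM lee_pmul2l ?lte_fin.
Qed.

(** A simple function below [f] plus one below [g] is a simple function below the sum. Without
    measurability the converse splitting can fail, so only an inequality is claimed. *)
Lemma ge0_lower_integralD d (T : measurableType d) (R : realType)
  (mu : {measure set T -> \bar R}) (f g : T -> \bar R) :
  (forall x, 0 <= f x)%E -> (forall x, 0 <= g x)%E ->
  (\int[mu]_x f x + \int[mu]_x g x <= \int[mu]_x (f x + g x))%E.
Proof.
move=> f0 g0; have fg0 x : (0 <= f x + g x)%E by rewrite adde_ge0.
(* Infinite integrals are settled by monotonicity; afterwards both suprema are finite and can be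
   approached within [e / 2]. *)
have [fy|fNy] := eqVneq (\int[mu]_x f x)%E +oo%E.
  apply: le_trans (leey _) _; rewrite -fy; apply: ge0_le_lower_integral => // x.
  by rewrite leeDl.
have [gy|gNy] := eqVneq (\int[mu]_x g x)%E +oo%E.
  apply: le_trans (leey _) _; rewrite -gy; apply: ge0_le_lower_integral => // x.
  by rewrite leeDr.
have ffin : (\int[mu]_x f x)%E \is a fin_num.
  by rewrite ge0_fin_numE ?integral_ge0// ltey.
have gfin : (\int[mu]_x g x)%E \is a fin_num.
  by rewrite ge0_fin_numE ?integral_ge0// ltey.
apply/lee_addgt0Pr => e e0; have e20 : 0 < e / 2 by rewrite divr_gt0.
move: ffin gfin; rewrite (ge0_integralTE _ f0) (ge0_integralTE _ g0).
rewrite (ge0_integralTE _ fg0).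
move=> /(ub_ereal_sup_adherent e20)[_ [h1 h1f <-] l1].
move=> /(ub_ereal_sup_adherent e20)[_ [h2 h2g <-] l2].
move: l1 l2; rewrite !lteBlDr// => /ltW l1 /ltW l2.
apply: le_trans (leeD l1 l2) _; rewrite addeACA -sintegralD -EFinD -splitr leeD2r//.
apply: ereal_sup_ubound; exists (add_nnsfun h1 h2) => // x /=.
by rewrite EFinD leeD// ?h1f// ?h2g.
Qed.

(** * Order and linearity properties of iterated integrals *)

Section iterated_integral.
Context {R : realType}.
Local Open Scope ereal_scope.
Implicit Types F G : seq R -> \bar R.

Lemma iint_ge0 k F : (forall s, 0 <= F s) -> 0 <= iint k F.
Proof. by elim: k F => [|k IH] F F0 //=; apply: integral_ge0 => x _; apply: IH. Qed.

Lemma le_iint_size k F G : (forall s, 0 <= F s) -> (forall s, 0 <= G s) ->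
  (forall s, size s = k -> F s <= G s) -> iint k F <= iint k G.
Proof.
elim: k F G => [|k IH] F G F0 G0 FG /=; first exact: FG.
apply: ge0_le_lower_integral => x; first exact: iint_ge0.
by apply: IH => // s sk; apply: FG; rewrite /= sk.
Qed.

Lemma le_iint k F G : (forall s, 0 <= F s) -> (forall s, F s <= G s) ->
  iint k F <= iint k G.
Proof.
by move=> F0 FG; apply: le_iint_size => // s; apply: le_trans (F0 s) (FG s).
Qed.

Lemma eq_iint k F G : F =1 G -> iint k F = iint k G.
Proof. by move/funext->. Qed.

Lemma iint_superD k F G : (forall s, 0 <= F s) -> (forall s, 0 <= G s) ->
  iint k F + iint k G <= iint k (fun s => F s + G s).
Proof.
elim: k F G => [|k IH] F G F0 G0 //=.
apply: le_trans (ge0_lower_integralD _ _ _ _ _ _ _ _) _; try by move=> *; apply: iint_ge0.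
apply: ge0_le_lower_integral => x; last exact: IH.
by rewrite adde_ge0// iint_ge0.
Qed.

Lemma iint0 k : iint k (fun _ : seq R => 0) = 0.
Proof.
elim: k => //= k IH; rewrite (_ : (fun x : R => _) = cst 0) ?integral0//.
by apply/funext => x.
Qed.

Lemma iint_superZ k (c : R) F : (0 <= c)%R -> (forall s, 0 <= F s) ->
  c%:E * iint k F <= iint k (fun s => c%:E * F s).
Proof.
move=> c0; elim: k F => [|k IH] F F0 //=.
apply: le_trans (ge0_lower_integralZ _ _ _ _ _ _ c0 _) _.
  by move=> *; apply: iint_ge0.
apply: ge0_le_lower_integral => x; last exact: IH.
by rewrite mule_ge0 ?lee_fin// iint_ge0.
Qed.

(** For [c > 0], the inequality [iint_superZ] applied with [c^-1] gives the reverse bound. *)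
Lemma iintZ k (c : R) F : (0 <= c)%R -> (forall s, 0 <= F s) ->
  iint k (fun s => c%:E * F s) = c%:E * iint k F.
Proof.
move=> c0 F0; have [->|cn0] := eqVneq c 0%R.
  by rewrite mul0e -[RHS](iint0 k); apply: eq_iint => s; rewrite mul0e.
have cp : (0 < c)%R by rewrite lt_neqAle eq_sym cn0.
apply/eqP; rewrite eq_le iint_superZ// andbT.
have ci0 : (0 <= c^-1)%R by rewrite invr_ge0.
have cF0 s : 0 <= c%:E * F s by rewrite mule_ge0 ?lee_fin.
have := iint_superZ k c^-1 (fun s => c%:E * F s) ci0 cF0.
under [leRHS]eq_iint => s do rewrite muleA -EFinM mulVf// mul1e.
by rewrite lee_pdivrMl.
Qed.

Lemma iint_super_sum k (I : Type) (r : seq I) (F : I -> seq R -> \bar R) :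
  (forall i s, 0 <= F i s) ->
  \sum_(i <- r) iint k (F i) <= iint k (fun s => \sum_(i <- r) F i s).
Proof.
move=> F0; elim: r => [|i r IH].
  by rewrite big_nil; apply: iint_ge0 => s; rewrite big_nil.
rewrite big_cons; under [leRHS]eq_iint => s do rewrite big_cons.
apply: le_trans (iint_superD _ _ _ _ _) => //; first by rewrite leeD2l.
by move=> s; apply: sume_ge0.
Qed.

(** * Joint measurability and Tonelli's theorem *)

(* [G s [:: x1; ...; xk]] is measurable in [(s, x1, ..., xk)]; the parameter
   [s] is what makes the inductions on [k] go through. *)
Fixpoint jmeas (k : nat) d (S : measurableType d) (G : S -> seq R -> \bar R) : Prop :=
  match k with
  | 0 => measurable_fun [set: S] (G ^~ [::])
  | k'.+1 => @jmeas k' _ (S * measurableTypeR R)%type (fun sx l => G sx.1 (sx.2 :: l))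
  end.

Lemma jmeas_iint k d (S : measurableType d) (G : S -> seq R -> \bar R) :
  (forall s l, 0 <= G s l) -> jmeas k d S G ->
  measurable_fun [set: S] (fun s => iint k (G s)).
Proof.
elim: k d S G => [|k IH] d S G G0 //= /IH H.
have := measurable_fun_fubini_tonelli_F (m2 := [the {sigma_finite_measure set _ -> \bar R} of
  @lebesgue_measure R]) _ (H (fun _ _ => G0 _ _)).
by apply => x; apply: iint_ge0.
Qed.

Lemma jmeas_comp k d d' (S : measurableType d) (S' : measurableType d')
  (G : S -> seq R -> \bar R) (h : S' -> S) :
  measurable_fun setT h -> jmeas k d S G -> jmeas k d' S' (fun s l => G (h s) l).
Proof.
elim: k d d' S S' G h => [|k IH] d d' S S' G h mh /=.
  by move=> mG; exact: (measurableT_comp mG mh).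
move=> /(IH _ _ _ (S' * measurableTypeR R)%type _ (fun sx => (h sx.1, sx.2))).
apply; apply: measurable_fun_pair => //; exact: measurableT_comp.
Qed.

Lemma jmeas_consl k d (S : measurableType d) (G : S -> seq R -> \bar R) s :
  jmeas k.+1 d S G -> jmeas k _ (measurableTypeR R) (fun x l => G s (x :: l)).
Proof.
move=> /=; apply: (jmeas_comp k _ _ (S * measurableTypeR R)%type (measurableTypeR R) _ (fun x => (s, x))).
exact: measurable_fun_pair.
Qed.

Lemma jmeas_cvg k d (S : measurableType d) (G : nat -> S -> seq R -> \bar R) H :
  (forall m, jmeas k d S (G m)) -> (forall s l, G m s l @[m --> \oo] --> H s l) ->
  jmeas k d S H.
Proof.
elim: k d S G H => [|k IH] d S G H /= mG GH.
  by apply: (emeasurable_fun_cvg (fun m s => G m s [::])) => // s _.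
by apply: IH mG _ => s l; apply: GH.
Qed.

Lemma jmeas_scale k d (S : measurableType d) (c : R) (G : S -> seq R -> \bar R) :
  jmeas k d S G -> jmeas k d S (fun s l => c%:E * G s l).
Proof.
elim: k d S G => [|k IH] d S G /=; first exact: measurable_funeM.
exact: IH.
Qed.

(** Peeling off the outermost variable moves it into the parameter space; termwise integration in
    one variable then applies, the inner integrals being measurable by [jmeas_iint]. The proof of
    [iint_lim] follows the same scheme. *)
Lemma iint_nneseries k d (S : measurableType d) (G : nat -> S -> seq R -> \bar R) s :
  (forall m s l, 0 <= G m s l) -> (forall m, jmeas k d S (G m)) ->
  iint k (fun l => \sum_(m <oo) G m s l) = \sum_(m <oo) iint k (G m s).
Proof.
elim: k d S G s => [|k IH] d S G s G0 mG //=.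
have mGs m := jmeas_consl k d S (G m) s (mG m).
rewrite -integral_nneseries//.
- by apply: eq_integral => x _; exact: (IH _ (measurableTypeR R) (fun m x l => G m s (x :: l))).
- by move=> m; apply: (jmeas_iint k _ (measurableTypeR R) (fun x l => G m s (x :: l))).
- by move=> m x _; apply: iint_ge0.
Qed.

Lemma iint_lim k d (S : measurableType d) (G : nat -> S -> seq R -> \bar R) s :
  (forall m s l, 0 <= G m s l) -> (forall m, jmeas k d S (G m)) ->
  (forall s l, {homo (fun m => G m s l) : m m' / (m <= m')%N >-> m <= m'}) ->
  iint k (fun l => limn (fun m => G m s l)) = limn (fun m => iint k (G m s)).
Proof.
elim: k d S G s => [|k IH] d S G s G0 mG ndG //=.
have mGs m := jmeas_consl k d S (G m) s (mG m).
rewrite -monotone_convergence//.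
- by apply: eq_integral => x _; exact: (IH _ (measurableTypeR R) (fun m x l => G m s (x :: l))).
- by move=> m; apply: (jmeas_iint k _ (measurableTypeR R) (fun x l => G m s (x :: l))).
- by move=> m x _; apply: iint_ge0.
- by move=> x _ m m' mm'; apply: le_iint => // l; apply: ndG.
Qed.

End iterated_integral.

(** * Functions constant on the cells of a grid *)

(** A condition on the relative position of [x] inside its grid cell of side [1 / c]; it serves to
    single out a cube concentric with the cell. *)
Definition in_frac {R : realType} (c a b x : R) : bool :=
  (a <= c * x - (Num.floor (c * x))%:~R < b)%R.

Section grid.
Context {R : realType}.
Local Open Scope ereal_scope.

Lemma nneseries_single (u : nat -> \bar R) j : (forall i, 0 <= u i) ->
  (forall i, i != j -> u i = 0) -> \sum_(i <oo) u i = u j.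
Proof.
move=> u0 uj; rewrite (@nneseriesD1 _ _ j xpredT)// eseries0 ?adde0//.
by move=> i _ /= /uj.
Qed.

Lemma in_fracP (c a b x : R) (z : int) : (0 < c)%R -> (0 <= a)%R -> (b <= 1)%R ->
  x \in `[((z%:~R + a) / c)%R, ((z%:~R + b) / c)%R[ =
  (Num.floor (c * x)%R == z) && in_frac c a b x.
Proof.
move=> c0 a0 b1; rewrite in_itv/= /in_frac ler_pdivrMr// ltr_pdivlMr// (mulrC x).
apply/idP/andP => [/andP[h1 h2]|[/eqP <-]]; last by lra.
have e : Num.floor (c * x)%R = z.
  by apply: floor_def; rewrite intrD; apply/andP; split; lra.
by rewrite e eqxx; split => //; lra.
Qed.

(** Each of the countably many cells of the line contributes an interval of length [(b - a) / c].
    The series runs over codes of integers, and indices that code no integer contribute 0. *)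
Lemma integral_floor_series (psi : int -> \bar R) (c a b : R) :
  (forall z, 0 <= psi z) -> (0 < c)%R -> (0 <= a)%R -> (a < b)%R -> (b <= 1)%R ->
  \int[@lebesgue_measure R]_x (if in_frac c a b x then psi (Num.floor (c * x)%R) else 0)
  = ((b - a) / c)%:E * \sum_(i <oo) (if @pickle_inv int i is Some z then psi z else 0).
Proof.
move=> psi0 c0 a0 ab b1.
pose J (z : int)  : set R := [set` `[((z%:~R + a) / c)%R, ((z%:~R + b) / c)%R[].
pose F (i : nat) (x : R) : \bar R :=
  if pickle_inv i is Some z then psi z * (\1_(J z) x)%:E else 0.
have F0 i x : 0 <= F i x.
  by rewrite /F; case: pickle_inv => // z; rewrite mule_ge0// lee_fin.
have mI z : measurable_fun [set: measurableTypeR R] (fun x => (\1_(J z) x)%:E).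
  apply/measurable_EFinP; apply: measurable_indic; exact: measurable_itv.
have mF i : measurable_fun [set: measurableTypeR R] (F i).
  rewrite /F; case: pickle_inv => [z|]; last exact: measurable_cst.
  by apply: emeasurable_funM => //; exact: measurable_cst.
rewrite (_ : (fun x => _) = (fun x => \sum_(i <oo) F i x)); last first.
  apply/funext => x; set z := Num.floor (c * x)%R.
  rewrite (nneseries_single _ (pickle z))//.
    rewrite /F pickleK_inv indicE /J mem_setE in_fracP// eqxx/=.
    by case: ifP => _; rewrite ?mule1 ?mule0.
  move=> i; rewrite /F; have := @pickle_invK int i.
  case: pickle_inv => //= z' iz' izn; rewrite indicE /J mem_setE in_fracP//.
  case: eqP => [zz'|_] /=; last by rewrite mule0.
  by move: izn; rewrite -iz' -zz' eqxx.
rewrite integral_nneseries// -nneseriesZl//; last by move=> i _; case: pickle_inv.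
congr (limn _); apply/funext => N; apply: eq_bigr => i _; rewrite /F.
case: pickle_inv => [z|]; last by rewrite mule0 integral0.
rewrite ge0_integralZl//.
rewrite integral_indic//; last exact: measurable_itv.
rewrite setIT muleC; congr (_ * _); apply: etrans (lebesgue_measure_itv _) _.
rewrite /= lte_fin ltr_pM2r ?invr_gt0// ltrD2l ab -EFinB.
by congr _%:E; field; apply: lt0r_neq0.
Qed.

(** The full integral is the case [a = 0], [b = 1], since a fractional part always lies in [[0, 1[];
    both sides are thus multiples of the same series. *)
Lemma integral_floor_frac (psi : int -> \bar R) (c a b : R) :
  (forall z, 0 <= psi z) -> (0 < c)%R -> (0 <= a)%R -> (a < b)%R -> (b <= 1)%R ->
  \int[@lebesgue_measure R]_x (if in_frac c a b x then psi (Num.floor (c * x)%R) else 0)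
  = (b - a)%:E * \int[@lebesgue_measure R]_x psi (Num.floor (c * x)%R).
Proof.
move=> psi0 c0 a0 ab b1; rewrite integral_floor_series//.
rewrite (_ : (fun x => psi _) = (fun x =>
  if in_frac c 0 1 x then psi (Num.floor (c * x)%R) else 0)); last first.
  apply/funext => x; rewrite /in_frac; have := floor_itv (c * x)%R.
  by rewrite intrD => /andP[h1 h2]; rewrite ifT//; apply/andP; split; lra.
by rewrite integral_floor_series// subr0 muleA -EFinM mul1r.
Qed.

Definition floors (c : R) (l : seq R) : seq int :=
  [seq Num.floor (c * x)%R | x <- l].

(** In every cell the selected points form a subcube of relative volume [(b - a) ^+ k]; each
    integration yields one factor. *)
Lemma iint_floors_frac k (phi : seq int -> \bar R) (c a b : R) :
  (forall w, 0 <= phi w) -> (0 < c)%R -> (0 <= a)%R -> (a < b)%R -> (b <= 1)%R ->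
  iint k (fun l => if all (in_frac c a b) l then phi (floors c l) else 0)
  = ((b - a) ^+ k)%:E * iint k (fun l => phi (floors c l)).
Proof.
move=> phi0 c0 a0 ab b1; elim: k phi phi0 => [|k IH] phi phi0 /=.
  by rewrite expr0 mul1e.
pose psi z := iint k (fun l => phi (z :: floors c l)).
have psi0 z : 0 <= psi z by apply: iint_ge0.
have ba0 : (0 <= (b - a) ^+ k)%R by rewrite exprn_ge0// subr_ge0 ltW.
transitivity (\int[@lebesgue_measure R]_x (if in_frac c a b x then
    ((b - a) ^+ k)%:E * psi (Num.floor (c * x)%R) else 0)).
  apply: eq_integral => x _; case: ifP => h; last first.
    by rewrite -[RHS](iint0 k); apply: eq_iint.
  exact: (IH (fun w => phi (Num.floor (c * x)%R :: w))).
rewrite (integral_floor_frac (fun z => ((b - a) ^+ k)%:E * psi z))//; last first.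
  by move=> z; rewrite mule_ge0 ?lee_fin.
rewrite exprS EFinM -muleA; congr (_ * _).
(* A one-dimensional integral is an [iint] of order 1; [head 0] reads the variable back from the
   list. *)
exact: (iintZ 1 _ (fun l => psi (Num.floor (c * head 0 l)%R))).
Qed.

(* [Z] records the cells already visited in the recursion defining [jmeas]. *)
Lemma jmeas_floors_aux k d (S : measurableType d) (Z : S -> seq int)
  (phi : seq int -> \bar R) (c : R) :
  (0 < c)%R -> (forall w, measurable (Z @^-1` [set w])) ->
  jmeas k d S (fun s l => phi (Z s ++ floors c l)).
Proof.
move=> c0; elim: k d S Z => [|k IH] d S Z mZ /=.
  move=> _ Y mY; rewrite setTI.
  (* Integer words are countable, so the preimage of [Y] is a countable union of the measurable sets
     on which the word is fixed. *)
  rewrite (_ : _ @^-1` Y = \bigcup_(w in setT) (if `[< Y (phi w) >] then Z @^-1` [set w] else set0)).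
    by apply: countable_bigcupT_measurable => // w; case: ifP.
  apply/seteqP; split => [s /=|s [w _]].
    by rewrite cats0 => Ys; exists (Z s) => //; rewrite ifT//; apply/asboolP.
  by case: asboolP => [Yw|_ []]; rewrite /preimage/= => Zw; rewrite cats0 Zw.
rewrite [X in jmeas _ _ _ X](_ : _ = fun (sx : S * measurableTypeR R) l =>
  phi (rcons (Z sx.1) (Num.floor (c * sx.2)%R) ++ floors c l)); last first.
  by apply/funext => sx; apply/funext => l; rewrite cat_rcons.
apply: (IH _ (S * measurableTypeR R)%type (fun sx => rcons (Z sx.1) (Num.floor (c * sx.2)%R))) => w.
case/lastP: w => [|w z].
  rewrite (_ : _ @^-1` _ = set0)//; apply/seteqP; split => // -[s x] /=.
  by case: (Z s).
rewrite (_ : _ @^-1` _ = (Z @^-1` [set w]) `*` [set` `[((z%:~R + 0) / c)%R, ((z%:~R + 1) / c)%R[]).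
  by apply: measurableX => //; exact: measurable_itv.
have fl x z' : x \in `[((z'%:~R + 0) / c)%R, ((z'%:~R + 1) / c)%R[ =
    (Num.floor (c * x)%R == z').
  by rewrite in_itv/= addr0 ler_pdivrMr// ltr_pdivlMr// (mulrC x) floor_eq intrD.
apply/seteqP; split => [[s x] /= /rcons_inj[<- <-]|[s x] /= [<-]].
  by split; rewrite ?fl.
by rewrite fl => /eqP ->.
Qed.

Lemma jmeas_floors k d (S : measurableType d) (phi : seq int -> \bar R) (c : R) :
  (0 < c)%R -> jmeas k d S (fun _ l => phi (floors c l)).
Proof.
move=> c0; apply: (jmeas_floors_aux k d S (fun=> [::])) => // w.
by rewrite preimage_cst; case: ifP.
Qed.

End grid.

(** * Lower semicontinuous functions as increasing limits over dyadic grids *)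

Section dyadic.
Context {R : realType}.

(** Dyadic grids are nested: the floor of [2 * x] is twice the floor of [x], or one more, and so
    determines the latter. *)
Lemma floor_dyadicS (m : nat) (x y : R) :
  Num.floor (2 ^+ m.+1 * x) = Num.floor (2 ^+ m.+1 * y) ->
  Num.floor (2 ^+ m * x) = Num.floor (2 ^+ m * y).
Proof.
rewrite exprS -!mulrA; move: (2 ^+ m * x) (2 ^+ m * y) => {x y} x y e.
have /andP[h1 h2] := floor_itv y; rewrite intrD in h2.
have h3 : 2 * Num.floor y <= Num.floor (2 * x).
  by rewrite e floor_ge_int intrM; lra.
have h4 : Num.floor (2 * x) < 2 * Num.floor y + 2.
  by rewrite e floor_lt_int intrD intrM; lra.
move: h3 h4; rewrite floor_ge_int floor_lt_int intrD intrM => h3 h4.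
by apply: floor_def; rewrite intrD; apply/andP; split; lra.
Qed.

Lemma floor_dyadic_dist (m : nat) (x y : R) :
  Num.floor (2 ^+ m * x) = Num.floor (2 ^+ m * y) -> `|x - y| < 2 ^- m.
Proof.
have p0 : 0 < (2 : R) ^+ m by rewrite exprn_gt0.
move=> e; rewrite -(ltr_pM2l p0) mulfV ?gt_eqF// -[X in X * _](gtr0_norm p0) -normrM.
have := floor_itv (2 ^+ m * x); have := floor_itv (2 ^+ m * y).
by rewrite e !intrD mulrBr ltr_norml => /andP[? ?] /andP[? ?]; apply/andP; split; lra.
Qed.

Lemma exprn2_small (e : R) : 0 < e -> exists m : nat, 2 ^- m < e.
Proof.
move=> e0; exists (Num.bound e^-1).
have ei0 : 0 <= e^-1 by rewrite invr_ge0 ltW.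
rewrite invf_plt ?posrE ?exprn_gt0//; apply: lt_le_trans (archi_boundP ei0) _.
by rewrite -natrX ler_nat ltnW// ltn_expl.
Qed.

End dyadic.

Definition rowl {R : realType} n (l : seq R) : 'rV[R]_n := \row_(i < n) nth 0 l i.

Definition lsc {T : topologicalType} {R : realType} (h : T -> \bar R) :=
  forall x (a : R), (a%:E < h x)%E -> \forall y \near x, (a%:E < h y)%E.

Section cells.
Context {R : realType} {n : nat}.
Implicit Types (h : 'rV[R]_n -> \bar R) (w : seq int) (l : seq R).

(** The half-open dyadic cube of side [2 ^- m] with index [w]; missing entries of [w] count as 0. *)
Definition cell (m : nat) (w : seq int) : set 'rV[R]_n :=
  [set y : 'rV[R]_n | forall i : 'I_n, Num.floor (2 ^+ m * y ord0 i) = nth 0 w i].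

Definition cellinf h m w : \bar R := ereal_inf (h @` cell m w).

Lemma nth_floors (c : R) l i : nth 0 (floors c l) i = Num.floor (c * nth 0 l i).
Proof.
have [il|il] := ltnP i (size l); first by rewrite (nth_map 0).
by rewrite !nth_default ?size_map// mulr0 floor0.
Qed.

Lemma cell_rowl m l : cell m (floors (2 ^+ m) l) (rowl n l).
Proof. by move=> i; rewrite nth_floors mxE. Qed.

Lemma cellinf_ge0 h m w : (forall x, 0 <= h x)%E -> (0 <= cellinf h m w)%E.
Proof. by move=> h0; apply: le_ereal_inf_tmp => _ [y _ <-]. Qed.

Lemma cellinf_le h m l : (cellinf h m (floors (2 ^+ m) l) <= h (rowl n l))%E.
Proof. by apply: ereal_inf_lbound; exists (rowl n l) => //; apply: cell_rowl. Qed.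

Lemma cellinf_nd h l :
  {homo (fun m => cellinf h m (floors (2 ^+ m) l)) : m m' / (m <= m')%N >-> (m <= m')%E}.
Proof.
apply/nondecreasing_seqP => m; apply: ereal_inf_le_tmp => _ [y cy <-].
exists y => // i; rewrite nth_floors; apply: floor_dyadicS.
by rewrite cy nth_floors.
Qed.

(** The sequence increases to its supremum [S], which is at most the value of [h]. If [a] is below
    that value, lower semicontinuity keeps [h] above [a] on a small enough cell, so [S] is at least
    [a]. *)
Lemma cellinf_cvg h l : (forall x, 0 <= h x)%E -> lsc h ->
  cellinf h m (floors (2 ^+ m) l) @[m --> \oo] --> h (rowl n l).
Proof.
move=> h0 lh; have := ereal_nondecreasing_cvgn (cellinf_nd h l).
set S := ereal_sup _; suff -> : S = h (rowl n l) by [].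
apply/eqP; rewrite eq_le; apply/andP; split.
  by apply: ge_ereal_sup => _ [m _ <-]; apply: cellinf_le.
have cS m : (cellinf h m (floors (2 ^+ m) l) <= S)%E by apply: ereal_sup_ubound; exists m.
have S0 : (0 <= S)%E by apply: le_trans (cS 0%N); apply: cellinf_ge0.
have lS (a : R) : (a%:E < h (rowl n l))%E -> (a%:E <= S)%E.
  move=> /lh /nbhs_ballP[e /= e0 be].
  have [m me] := exprn2_small e e0.
  apply: le_trans (cS m); apply: le_ereal_inf_tmp => _ [y cy <-].
  apply/ltW/be; split => // i j; rewrite (ord1 i) /ball/=; apply: lt_trans me.
  by apply: floor_dyadic_dist; rewrite cy nth_floors mxE.
(* If [S] were smaller, [lS] would fail at the midpoint when the value of [h] is finite, and at
   [s + 1] when it is infinite. *)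
rewrite leNgt; apply/negP => Sh.
case: S S0 Sh lS {cS} => [s _|_|] //; last by rewrite ltNge leey.
case: (h (rowl n l)) => [t| |] //=.
  rewrite lte_fin => st /(_ ((s + t) / 2)%R); rewrite lte_fin lee_fin => H.
  have : (s + t) / 2 <= s by apply: H; lra.
  lra.
move=> _ /(_ (s + 1)%R); rewrite ltry lee_fin => /(_ isT); lra.
Qed.

Lemma jmeas_cellinf h m k d (S : measurableType d) :
  jmeas k d S (fun _ (l : seq R) => cellinf h m (floors (2 ^+ m) l)).
Proof. exact: jmeas_floors. Qed.

Lemma jmeas_lsc h k d (S : measurableType d) : (forall x, 0 <= h x)%E -> lsc h ->
  jmeas k d S (fun _ l => h (rowl n l)).
Proof.
move=> h0 lh; apply: (jmeas_cvg k d S _ _ (fun m => jmeas_cellinf h m k d S)).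
by move=> _ l; apply: cellinf_cvg.
Qed.

(** Monotone convergence for the cellwise infima, with the one-point type [unit] as initial
    parameter space. *)
Lemma iint_lsc_lim h k : (forall x, 0 <= h x)%E -> lsc h ->
  iint k (fun l => h (rowl n l)) =
  limn (fun m => iint k (fun l : seq R => cellinf h m (floors (2 ^+ m) l))).
Proof.
move=> h0 lh.
rewrite -(iint_lim k _ unit (fun m _ (l : seq R) => cellinf h m (floors (2 ^+ m) l)) tt).
- by apply: eq_iint => l; apply/esym/cvg_lim => //; exact: cellinf_cvg.
- by move=> *; apply: cellinf_ge0.
- by move=> m; apply: jmeas_cellinf.
- by move=> _ l; apply: cellinf_nd.
Qed.

End cells.

(** * Unions of balls with separated centres are admissible *)

Section quadratic.
Context {R : realType} {n : nat}.
Local Notation V := 'rV[R]_n.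

(** Quadratic polynomials, valued in rows of length 1 to fit [smooth_submanifold]. The family
    contains the defining functions of spheres and is closed under directional derivatives, whence
    smoothness. *)
Definition quadf (a : R) (b : V) (d : R) (y : V) : 'rV[R]_1 :=
  (a * (\sum_(i < n) y ord0 i ^+ 2) + \sum_(i < n) b ord0 i * y ord0 i + d)
  *: const_mx 1.

Lemma is_derive_quadf a b d x v :
  is_derive x v (quadf a b d)
    (quadf 0 ((2 * a) *: v) (\sum_(i < n) b ord0 i * v ord0 i) x).
Proof.
set L := quadf _ _ _ x.
have H : (h^-1 *: (quadf a b d (h *: v + x) - quadf a b d x)) @[h --> 0^'] --> L.
  (* The difference quotient of a quadratic is exactly its limit [L] plus a term linear in [h]. *)
  have E : \forall h \near (0:R)^', L + h *: ((a * \sum_(i < n) v ord0 i ^+ 2) *: const_mx 1)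
      = h^-1 *: (quadf a b d (h *: v + x) - quadf a b d x).
    near=> h; have h0 : h != 0 by near: h; exact: nbhs_dnbhs_neq.
    rewrite /L /quadf -scalerBl !scalerA -scalerDl; congr (_ *: _).
    apply: (mulfI h0); rewrite [RHS]mulrA mulfV// mul1r.
    rewrite (_ : \sum_(i < n) (h *: v + x) ord0 i ^+ 2 =
      h ^+ 2 * (\sum_(i < n) v ord0 i ^+ 2) + 2 * h * (\sum_(i < n) v ord0 i * x ord0 i)
      + \sum_(i < n) x ord0 i ^+ 2); last first.
      by rewrite !mulr_sumr -!big_split; apply: eq_bigr => i _; rewrite !mxE /=; ring.
    rewrite (_ : \sum_(i < n) b ord0 i * (h *: v + x) ord0 i =
      h * (\sum_(i < n) b ord0 i * v ord0 i) + \sum_(i < n) b ord0 i * x ord0 i); last first.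
      by rewrite !mulr_sumr -!big_split; apply: eq_bigr => i _; rewrite !mxE /=; ring.
    rewrite (_ : \sum_(i < n) (2 * a *: v) ord0 i * x ord0 i =
      2 * a * \sum_(i < n) v ord0 i * x ord0 i); last first.
      by rewrite mulr_sumr; apply: eq_bigr => i _; rewrite !mxE mulrA.
    ring.
  set Q : 'rV[R]_1 := _ *: _ in E.
  apply: cvg_trans (near_eq_cvg E) _.
  have : (fun h : R => L + h *: Q) @ (0 : R)^' --> L + 0 *: Q.
    apply: cvgD; first exact: cvg_cst.
    by apply: cvgZr_tmp; exact: nbhs_dnbhs.
  by rewrite scale0r addr0.
split; first by apply/cvg_ex; exists L.
by apply/cvg_lim => //; exact: norm_hausdorff.
Unshelve. all: by end_near. Qed.

Lemma cvgr_sum (F : 'I_n -> V -> R) (y : V) :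
  (forall i, F i z @[z --> y] --> F i y) ->
  (\sum_(i < n) F i z) @[z --> y] --> \sum_(i < n) F i y.
Proof.
by move=> H; apply: cvg_big => //; [exact: add_continuous|exact: nbhs_filter].
Qed.

Lemma sqnorm_continuous (c : V) :
  continuous (fun y : V => \sum_(i < n) (y - c) ord0 i ^+ 2).
Proof.
move=> y; apply: cvgr_sum => i; rewrite expr2.
rewrite (_ : (fun z : V => _) =
  (fun z => (z ord0 i - c ord0 i) * (z ord0 i - c ord0 i))); last first.
  by apply/funext => z; rewrite !mxE expr2.
have -> : (y - c) ord0 i = y ord0 i - c ord0 i by rewrite !mxE.
have H1 : (fun z : V => z ord0 i) @ y --> y ord0 i by apply: coord_continuous.
have H2 : (fun z : V => z ord0 i - c ord0 i) @ y --> y ord0 i - c ord0 i.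
  exact: (cvgB H1 (cvg_cst (c ord0 i))).
exact: (cvgM H2 H2).
Qed.

Lemma quadf_continuous a b d : continuous (quadf a b d).
Proof.
move=> y.
have H i : (fun z : V => z ord0 i) @ y --> y ord0 i by apply: coord_continuous.
have H2 : (fun z : V => \sum_(i < n) z ord0 i ^+ 2) @ y --> \sum_(i < n) y ord0 i ^+ 2.
  by apply: cvgr_sum => i; rewrite expr2; under eq_fun do rewrite expr2; exact: (cvgM (H i) (H i)).
have H1 : (fun z : V => \sum_(i < n) b ord0 i * z ord0 i) @ y -->
    \sum_(i < n) b ord0 i * y ord0 i.
  by apply: cvgr_sum => i; exact: (cvgM (cvg_cst _) (H i)).
have H3 : (fun z : V => a * (\sum_(i < n) z ord0 i ^+ 2) +
    \sum_(i < n) b ord0 i * z ord0 i + d) @ y -->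
    a * (\sum_(i < n) y ord0 i ^+ 2) + \sum_(i < n) b ord0 i * y ord0 i + d.
  exact: (cvgD (cvgD (cvgM (cvg_cst a) H2) H1) (cvg_cst d)).
exact: (cvgZr_tmp H3).
Qed.

Lemma ider_quadf vs a b d :
  exists a' b' d', ider vs (quadf a b d) = quadf a' b' d'.
Proof.
elim: vs a b d => [|v vs IH] a b d /=; first by exists a, b, d.
rewrite (_ : 'D_v (quadf a b d) =
  quadf 0 ((2 * a) *: v) (\sum_(i < n) b ord0 i * v ord0 i)); first exact: IH.
by apply/funext => x; have [] := is_derive_quadf a b d x v.
Qed.

Lemma smooth_quadf U a b d : smooth_on_set U (quadf a b d).
Proof.
move=> vs; have [a' [b' [d' ->]]] := ider_quadf vs a b d; split.
  by apply: continuous_subspaceT => x; exact: quadf_continuous.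
by move=> v x _; have [] := is_derive_quadf a' b' d' x v.
Qed.

Lemma enorm_lt (v : V) r : 0 < r -> (enorm v < r) = (\sum_(i < n) v ord0 i ^+ 2 < r ^+ 2).
Proof.
move=> r0; rewrite /enorm -[X in _ < X](gtr0_norm r0) -sqrtr_sqr ltr_sqrt//.
by rewrite exprn_gt0.
Qed.

Lemma coord_le_enorm (v : V) i : `|v ord0 i| <= enorm v.
Proof.
rewrite /enorm -sqrtr_sqr ler_wsqrtr// (bigD1 i)//= lerDl sumr_ge0// => j _.
exact: sqr_ge0.
Qed.

Lemma open_eball (c : V) r : 0 < r -> open (eball c r).
Proof.
move=> r0; rewrite (_ : eball c r =
  (fun y : V => \sum_(i < n) (y - c) ord0 i ^+ 2) @^-1` [set x | x < r ^+ 2]).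
  by apply: open_comp; [move=> x _; exact: sqnorm_continuous|exact: open_lt].
by apply/funext => y; rewrite /eball/preimage/= enorm_lt.
Qed.

End quadratic.

Section dots.
Context {R : realType} {n : nat}.
Local Notation V := 'rV[R]_n.

Definition center (m : nat) (w : seq int) : V :=
  \row_(i < n) (((nth 0 w i)%:~R + 2^-1) * 2 ^- m).

(** A radius of a quarter of the side keeps each ball inside its cell and distinct balls at least
    half a side apart. *)
Definition dots (E : set V) (m : nat) : set V :=
  \bigcup_(w in [set w | cell m w `<=` E]) eball (center m w) (2 ^- m / 4).

Lemma exprV2_gt0 m : 0 < 2 ^- m :> R.
Proof. by rewrite invr_gt0 exprn_gt0. Qed.

Lemma eball_center_coord m w r (y : V) i : eball (center m w) r y ->
  `|y ord0 i - ((nth 0 w i)%:~R + 2^-1) * 2 ^- m| < r.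
Proof.
rewrite /eball/= => /(le_lt_trans (coord_le_enorm _ i)).
by rewrite !mxE.
Qed.

Lemma eball_center_cell m w : eball (center m w) (2 ^- m / 4) `<=` cell m w.
Proof.
move=> y yB i; apply: floor_def.
have := eball_center_coord m w _ y i yB.
have p0 : 0 < (2 : R) ^+ m by rewrite exprn_gt0.
rewrite -(ltr_pM2l p0) -[X in X * `|_|](gtr0_norm p0) -normrM mulrBr.
rewrite [X in _ - X]mulrCA [in X in _ < X]mulrA mulfV ?gt_eqF// mulr1 mul1r.
by rewrite ltr_norml intrD => /andP[h1 h2]; apply/andP; split; lra.
Qed.

Lemma dots_sub E m : dots E m `<=` E.
Proof. by move=> y [w wE /eball_center_cell /wE]. Qed.

Lemma open_dots E m : open (dots E m).
Proof.
by apply: bigcup_open => w _; apply: open_eball; rewrite divr_gt0 ?exprV2_gt0.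
Qed.

(** The coordinates of the two centres differ by less than 1/4 + 1/8 + 1/8 + 1/4 = 3/4 of the side,
    yet by an integer multiple of it. *)
Lemma near_center_uniq m w w' (x y y' : V) :
  ball x (2 ^- m / 8) y -> ball x (2 ^- m / 8) y' ->
  eball (center m w) (2 ^- m / 4) y -> eball (center m w') (2 ^- m / 4) y' ->
  center m w = center m w'.
Proof.
move=> [_ xy] [_ xy'] yw yw'; apply/rowP => i; rewrite !mxE.
have := xy ord0 i; have := xy' ord0 i; rewrite /ball/=.
have := eball_center_coord m w _ y i yw; have := eball_center_coord m w' _ y' i yw'.
have q0 := exprV2_gt0 m; set q := 2 ^- m in q0 *.
rewrite !ltr_norml => /andP[a1 a2] /andP[b1 b2] /andP[c1 c2] /andP[d1 d2].
have : `|((nth 0 w i - nth 0 w' i)%:~R : R)| * q < 1 * q.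
  by rewrite -[X in _ * X](gtr0_norm q0) -normrM ltr_norml intrB; apply/andP; split; lra.
rewrite ltr_pM2r// -intr_norm -[X in _ < X]/(1%:~R) ltr_int -[X in _ < X]add0r ltzD1 normr_le0 subr_eq0.
by move=> /eqP ->.
Qed.

(** Near a boundary point only one ball of the union is visible, so the boundary is locally a
    sphere: the zero set of a quadratic whose gradient does not vanish there. *)
Lemma admissible_dots Om E m : open Om -> E `<=` Om -> admissible Om (dots E m).
Proof.
move=> oOm EOm; split; [exact: subset_trans (dots_sub E m) EOm|exact: open_dots|].
exists 1%N => x [[clx Nx] Omx].
have q0 := exprV2_gt0 m.
pose r : R := 2 ^- m / 4; have r0 : 0 < r by rewrite divr_gt0.
have e0 : 0 < (2 ^- m / 8 : R) by rewrite divr_gt0.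
have [y0 [[w wE y0w] xy0]] := clx _ (nbhsx_ballx x _ e0).
set c := center m w.
pose W : set V := interior (ball x (2 ^- m / 8)).
have AW y : W y -> dots E m y <-> eball c r y.
  move=> /interior_subset xy; split => [[w' w'E yw']|yc]; last by exists w.
  by rewrite /c (near_center_uniq m w w' x y0 y).
have sq0 : 0 < r ^+ 2 by rewrite exprn_gt0.
have bdP y : W y -> bdry (dots E m) y <-> \sum_(i < n) (y - c) ord0 i ^+ 2 = r ^+ 2.
  move=> Wy; have oA := open_dots E m; rewrite /bdry (iffLR (interior_id _) oA).
  split=> [[cly Ay]|yr].
    apply/eqP; rewrite eq_le; apply/andP; split; rewrite leNgt; apply/negP => yr.
      (* Outside the sphere, [Z] is a neighbourhood of [y] that misses the union, so [y] is not in
         its closure. *)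
      pose Z := W `&` ((fun y : V => \sum_(i < n) (y - c) ord0 i ^+ 2) @^-1` [set t | r ^+ 2 < t]).
      have oZ : open Z.
        apply: openI; first exact: open_interior.
        by apply: open_comp; [move=> t _; exact: sqnorm_continuous|exact: open_gt].
      have [z [Az [Wz /= zr]]] := cly Z (open_nbhs_nbhs (conj oZ (conj Wy yr))).
      move: Az => /(AW _ Wz); rewrite /eball/= enorm_lt// => zr'.
      by have := lt_trans zr zr'; rewrite ltxx.
    by apply: Ay; apply/(AW _ Wy); rewrite /eball/= enorm_lt.
  split; last first.
    by move=> /(AW _ Wy); rewrite /eball/= enorm_lt// yr ltxx.
  move=> Z yZ; have : nbhs y (Z `&` W).
    by apply: filterI => //; apply: open_nbhs_nbhs; split => //; exact: open_interior.
  move=> /nbhs_ballP[e /= ep eZ].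
  (* Moving from [y] towards the centre by the fraction [t] enters the ball; [t * r < e] keeps the
     point near [y], and [t <= 1 / 2] gives [(1 - t) ^+ 2 < 1]. *)
  pose t : R := Num.min (e / 2 / r) (1 / 2).
  have t0 : 0 < t by rewrite lt_min !divr_gt0.
  have t1 : t <= 1 / 2 by rewrite ge_min lexx orbT.
  have tr : t * r < e.
    apply: (@le_lt_trans _ _ (e / 2)); last by rewrite ltr_pdivrMr// ltr_pMr// ltr1n.
    by rewrite -ler_pdivlMr// ge_min lexx.
  pose z := y - t *: (y - c).
  have [Zz Wz] : (Z `&` W) z.
    apply: eZ; split => // i j; rewrite (ord1 i) /ball/= /z !mxE subKr.
    rewrite normrM (gtr0_norm t0); apply: le_lt_trans tr; rewrite ler_pM2l//.
    have := coord_le_enorm (y - c) j; rewrite /enorm yr sqrtr_sqr (gtr0_norm r0).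
    by rewrite !mxE.
  exists z; split => //; apply/(AW _ Wz); rewrite /eball/= enorm_lt//.
  have -> : \sum_(i < n) (z - c) ord0 i ^+ 2 = (1 - t) ^+ 2 * r ^+ 2.
    by rewrite -yr mulr_sumr; apply: eq_bigr => i _; rewrite !mxE; ring.
  by rewrite gtr_pMl//; nra.
pose F := @quadf R n 1 (- 2 *: c) (\sum_(i < n) c ord0 i ^+ 2 - r ^+ 2).
have FE y : F y = (\sum_(i < n) (y - c) ord0 i ^+ 2 - r ^+ 2) *: const_mx 1.
  rewrite /F /quadf mul1r addrA -!big_split/=; congr ((_ - _) *: _).
  by apply: eq_bigr => i _; rewrite !mxE; ring.
exists (W `&` Om), F; split.
- by apply: openI => //; exact: open_interior.
- by split => //; apply: nbhsx_ballx.
- exact: smooth_quadf.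
- move=> y [Wy Omy] [/(bdP _ Wy) yr _] v.
  (* In the radial direction [y - c] the derivative of [F] at [y] is [2 * r ^+ 2], so a multiple of
     it attains any prescribed value. *)
  exists ((v ord0 ord0 / (2 * r ^+ 2)) *: (y - c)).
  set t := _ / _.
  have [_ ->] := is_derive_quadf 1 (- 2 *: c) (\sum_(i < n) c ord0 i ^+ 2 - r ^+ 2) y (t *: (y - c)).
  have -> : v = (2 * t * r ^+ 2) *: const_mx 1.
    apply/rowP => j; rewrite !mxE mulr1 (ord1 j) /t; field.
    by rewrite gt_eqF.
  rewrite -yr /quadf mul0r add0r -big_split/= mulr_sumr; congr (_ *: _).
  by apply: eq_bigr => i _; rewrite !mxE; ring.
- move=> y [Wy Omy]; rewrite FE; split.
    by move=> [/(bdP _ Wy) -> _]; rewrite subrr scale0r.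
  move=> /(congr1 (fun M : 'rV[R]_1 => M ord0 ord0)); rewrite !mxE mulr1 => /eqP.
  by rewrite subr_eq0 => /eqP yr; split => //; apply/bdP.
Qed.
End dots.

(** * The share of an integral carried by the balls *)

Section lint_dots.
Context {R : realType} {n : nat}.
Local Notation V := 'rV[R]_n.

Definition on_set (E : set V) (h : V -> \bar R) (x : V) : \bar R :=
  if `[< E x >] then h x else 0%E.

Lemma lintE (E : set V) h : lint E h = iint n (fun l => on_set E h (rowl n l)).
Proof. by []. Qed.

Lemma on_set_ge0 (E : set V) h x : (forall y, E y -> 0 <= h y)%E -> (0 <= on_set E h x)%E.
Proof. by rewrite /on_set; case: asboolP => // Ex; apply. Qed.

(** On the open set [E] this is continuity of [f]; off [E] the value is 0 and nearby values are
    nonnegative. *)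
Lemma lsc_on_set (Om E : set V) (f : V -> R) :
  open Om -> open E -> E `<=` Om -> {within Om, continuous f} ->
  (forall x, E x -> 0 <= f x) -> lsc (on_set E (EFin \o f)).
Proof.
move=> oOm oE EOm cf f0 x a; rewrite {1}/on_set; case: asboolP => [Ex|_ a0].
  rewrite lte_fin => afx.
  have fx : {for x, continuous f}.
    by move: cf; rewrite continuous_open_subspace// => /(_ x); apply; rewrite inE; apply: EOm.
  have Hx : \forall y \near x, a < f y.
    by apply: (cvgr_gt (f x) fx).
  near=> y; rewrite /on_set asboolT/= ?lte_fin; near: y => //.
  exact: open_nbhs_nbhs.
near=> y; apply: lt_le_trans a0 _; apply: on_set_ge0 => z Ez.
by rewrite lee_fin f0.
Unshelve. all: by end_near. Qed.

(** The relative volume of the concentric cube whose side is [1 / (4 * n.+1)] of that of the cell.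
    By [mem_dots] the ball contains this cube. *)
Definition dots_density : R := (4 * n.+1%:R)^-1 ^+ n.

Lemma dots_density_gt0 : 0 < dots_density.
Proof. by rewrite exprn_gt0// invr_gt0 mulr_gt0// ltr0n. Qed.

(** Each coordinate is within [e] times the side of the centre, where [e = 1 / (8 * n.+1)], and
    [n * e ^+ 2 < 1 / 16]. *)
Lemma mem_dots (E : set V) m l : size l = n ->
  all (in_frac (2 ^+ m) (2^-1 - (8 * n.+1%:R)^-1) (2^-1 + (8 * n.+1%:R)^-1)) l ->
  cell m (floors (2 ^+ m) l) `<=` E -> dots E m (rowl n l).
Proof.
move=> ln lI cE; exists (floors (2 ^+ m) l) => //.
have q0 := @exprV2_gt0 R m; have p0 : 0 < (2 : R) ^+ m by rewrite exprn_gt0.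
set N : R := n.+1%:R; have N0 : 0 < N by rewrite ltr0n.
set e := (8 * N)^-1; have e0 : 0 < e by rewrite invr_gt0 mulr_gt0.
rewrite /eball/= enorm_lt ?divr_gt0//.
apply: (@le_lt_trans _ _ (\sum_(i < n) (e * 2 ^- m) ^+ 2)).
  apply: ler_sum => i _; rewrite !mxE nth_floors -[leLHS]real_normK ?num_real//.
  rewrite lerXn2r ?nnegrE ?mulr_ge0// ?(ltW e0)// ?(ltW q0)//.
  have : in_frac (2 ^+ m) (2^-1 - e) (2^-1 + e) (nth 0 l i).
    by move/all_nthP : lI; apply; rewrite ln.
  rewrite /in_frac => /andP[h1 h2].
  have -> : nth 0 l i - ((Num.floor (2 ^+ m * nth 0 l i))%:~R + 2^-1) * 2 ^- m =
    (2 ^+ m * nth 0 l i - (Num.floor (2 ^+ m * nth 0 l i))%:~R - 2^-1) * 2 ^- m.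
    by field; rewrite gt_eqF.
  rewrite normrM (gtr0_norm q0) ler_pM2r// ler_norml; apply/andP; split; lra.
rewrite sumr_const card_ord; set q : R := 2 ^- m in q0 *.
rewrite [ltLHS](_ : _ = q ^+ 2 * (n%:R * e ^+ 2)); last by rewrite -mulr_natl; ring.
rewrite [ltRHS](_ : _ = q ^+ 2 * 4^-1 ^+ 2); last by ring.
rewrite ltr_pM2l ?exprn_gt0//.
have nN : n%:R <= N by rewrite ler_nat.
have -> : e ^+ 2 = (64 * N ^+ 2)^-1 by rewrite /e; field; rewrite gt_eqF.
rewrite ltr_pdivrMr ?mulr_gt0 ?exprn_gt0//.
have N1 : 1 <= N by rewrite ler1n.
nra.
Qed.

Lemma lint_dots (E : set V) (f : V -> R) m : (forall x, E x -> 0 <= f x) ->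
  (dots_density%:E * iint n (fun l => cellinf (on_set E (EFin \o f)) m (floors (2 ^+ m) l))
  <= lint (dots E m) (EFin \o f))%E.
Proof.
move=> f0; have h0 x : (0 <= on_set E (EFin \o f) x)%E.
  by apply: on_set_ge0 => y Ey; rewrite lee_fin f0.
have N0 : 0 < (n.+1%:R : R) by rewrite ltr0n.
have N1 : 1 <= (n.+1%:R : R) by rewrite ler1n.
set e : R := (8 * n.+1%:R)^-1.
have e0 : 0 < e by rewrite invr_gt0 mulr_gt0.
have e1 : e <= 1 / 8.
  by rewrite /e div1r lef_pV2 ?posrE ?mulr_gt0// ler_peMr.
have -> : dots_density = ((2^-1 + e) - (2^-1 - e)) ^+ n.
  by rewrite /dots_density /e; congr (_ ^+ _); field; rewrite gt_eqF.
rewrite -iint_floors_frac ?exprn_gt0//; last 4 first.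
- by move=> w; apply: cellinf_ge0.
- lra.
- lra.
- lra.
rewrite lintE; apply: le_iint_size => l.
- by case: ifP => // _; apply: cellinf_ge0.
- by apply: on_set_ge0 => x /dots_sub /f0; rewrite lee_fin.
move=> ln; case: ifP => [lI|_]; last first.
  by apply: on_set_ge0 => x /dots_sub /f0; rewrite lee_fin.
have [cE|] := pselect (cell m (floors (2 ^+ m) l) `<=` E).
  apply: le_trans (cellinf_le _ _ _) _.
  have D : dots E m (rowl n l) by apply: mem_dots.
  by rewrite /on_set !asboolT//; apply: dots_sub D.
(* A cell not inside [E] has a point where the extension by zero vanishes, so its infimum
   contributes nothing. *)
move=> /existsNP[y /not_implyP[cy Ey]].
apply: (@le_trans _ _ (on_set E (EFin \o f) y)).
  by apply: ereal_inf_lbound; exists y.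
rewrite {1}/on_set asboolF//; apply: on_set_ge0 => x /dots_sub /f0.
by rewrite lee_fin.
Qed.

(* The balls fill a fixed proportion of [E], up to the cubes not inside [E],
   which disappear as the mesh goes to 0. *)
Lemma le_lint_dots (Om E : set V) (f : V -> R) (Y : \bar R) :
  open Om -> open E -> E `<=` Om -> {within Om, continuous f} ->
  (forall x, E x -> 0 <= f x) ->
  (forall m, lint (dots E m) (EFin \o f) <= Y)%E ->
  (dots_density%:E * lint E (EFin \o f) <= Y)%E.
Proof.
move=> oOm oE EOm cf f0 H.
have h0 x : (0 <= on_set E (EFin \o f) x)%E.
  by apply: on_set_ge0 => y Ey; rewrite lee_fin f0.
have K0 := dots_density_gt0.
rewrite lintE iint_lsc_lim//; last exact: lsc_on_set oOm oE EOm cf f0.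
rewrite muleC -lee_pdivlMr//; apply: lime_le.
  apply: ereal_nondecreasing_is_cvgn => m m' mm'; apply: le_iint => l.
    exact: cellinf_ge0.
  exact: cellinf_nd.
apply: nearW => m; rewrite lee_pdivlMr// muleC.
by apply: le_trans (H m); apply: lint_dots.
Qed.

End lint_dots.

(** * Dyadic scales and truncation layers *)

Section scales.
Context {R : realType}.

(* An enumeration of all integer powers of 2: 1, 1/2, 2, 1/4, 4, 1/8, ... *)
Definition scale (i : nat) : R := if odd i then 2 ^- (i./2.+1) else 2 ^+ i./2.

Lemma scale_gt0 i : 0 < scale i.
Proof. by rewrite /scale; case: ifP => _; rewrite ?invr_gt0 exprn_gt0. Qed.

Definition layer (s t : R) : R := Num.min t (2 * s) - Num.min t s.

Lemma layer_nd s a b : 0 < s -> a <= b -> layer s a <= layer s b.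
Proof.
by move=> s0 ab; rewrite /layer /Num.min; repeat case: ltP => ?; lra.
Qed.

(** The first [N.*2] scales are the powers of 2 from [2 ^- N] to [2 ^+ N.-1] (for [N > 0]), so the
    layers telescope. *)
Lemma sum_layer N t :
  \sum_(i < N.*2) layer (scale i) t = Num.min t (2 ^+ N) - Num.min t (2 ^- N).
Proof.
elim: N => [|N IH]; first by rewrite big_ord0 expr0 invr1 subrr.
rewrite doubleS !big_ord_recr/= IH /layer /scale /= odd_double/= uphalf_double doubleK.
rewrite -!exprVn !exprS.
have -> : 2 * (2^-1 * 2^-1 ^+ N) = 2^-1 ^+ N :> R by rewrite mulrA mulfV// mul1r.
lra.
Qed.

(** Layers are nondecreasing, so for [b <= a] the absolute values disappear. Enlarging the sum to
    [N.*2] terms makes it telescope to an increment of a 1-Lipschitz function. *)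
Lemma sum_layer_dist N a b : 0 <= a -> 0 <= b ->
  \sum_(i < N) `|layer (scale i) a - layer (scale i) b| <= `|a - b|.
Proof.
move=> a0 b0; wlog ab : a b a0 b0 / b <= a.
  move=> H; have [/H|/ltW /H] := leP b a; first exact.
  by rewrite distrC; under eq_bigr do rewrite distrC; apply.
rewrite [leRHS]ger0_norm ?subr_ge0//.
have mono i : layer (scale i) b <= layer (scale i) a.
  by apply: layer_nd => //; apply: scale_gt0.
under eq_bigr do rewrite ger0_norm ?subr_ge0//.
have le2 : (N <= N.*2)%N by rewrite -addnn leq_addr.
apply: (@le_trans _ _ (\sum_(i < N.*2) (layer (scale i) a - layer (scale i) b))).
  rewrite -!(big_mkord xpredT (fun i => layer (scale i) a - layer (scale i) b)).
  rewrite (big_cat_nat (leq0n N) le2)/= lerDl sumr_ge0// => i _.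
  by rewrite subr_ge0.
rewrite big_split/= sumrN !sum_layer.
have N0 : 0 < 2 ^- N :> R by rewrite invr_gt0 exprn_gt0.
have N1 : 2 ^- N <= 2 ^+ N :> R.
  apply: (@le_trans _ _ 1); last by rewrite exprn_ege1// ler1n.
  by rewrite invf_le1 ?exprn_gt0// exprn_ege1// ler1n.
by rewrite /Num.min; repeat case: ltP => ?; lra.
Qed.

(** A least exponent does it: among the odd indices, which carry the negative powers, if [t <= 1],
    and among the even ones otherwise. *)
Lemma scale_bracket t : 0 < t -> exists i, scale i < t <= 2 * scale i.
Proof.
move=> t0; have [t1|t1] := leP t 1.
  have ex : exists j, 2 ^- j.+1 < t.
    have [j jt] := exprn2_small t t0; exists j; apply: le_lt_trans jt.
    by rewrite lef_pV2 ?posrE ?exprn_gt0// ler_weXn2l// ler1n.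
  case: (ex_minnP ex) => j jt jmin; exists j.*2.+1.
  rewrite /scale /= odd_double/= uphalf_double jt/= exprS invfM mulrA mulfV// mul1r.
  case: j jt jmin => [|j] jt jmin; first by rewrite expr0 invr1.
  by rewrite leNgt; apply/negP => /jmin; rewrite ltnn.
have ex : exists j, t <= 2 ^+ j.+1.
  exists (Num.bound t); apply/ltW; apply: lt_trans (archi_boundP (ltW t0)) _.
  rewrite -natrX ltr_nat; apply: (@leq_trans (2 ^ Num.bound t)); first exact: ltn_expl.
  by rewrite leq_exp2l.
case: (ex_minnP ex) => j jt jmin; exists j.*2.
rewrite /scale odd_double doubleK -exprS jt andbT.
case: j jt jmin => [|j] jt jmin; first by rewrite expr0.
by rewrite ltNge; apply/negP => /jmin; rewrite ltnn.
Qed.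

(** Each term satisfies [d i]^ e <= d i * D [^ (e - 1)]. It serves with exponent [p] for the layers
    and with [q / p] for the sum over scales. *)
Lemma sum_powR_le (I : Type) (r : seq I) (d : I -> R) (D e : R) : 1 <= e ->
  (forall i, 0 <= d i) -> \sum_(i <- r) d i <= D ->
  \sum_(i <- r) d i `^ e <= D `^ e.
Proof.
move=> e1 d0 dD; have e0 : 0 < e by apply: lt_le_trans e1.
have D0 : 0 <= D by apply: le_trans dD; apply: sumr_ge0.
elim: r D dD D0 => [|i r IH] D dD D0; first by rewrite big_nil powR_ge0.
move: dD; rewrite !big_cons => dD.
have S0 : 0 <= \sum_(j <- r) d j by apply: sumr_ge0.
have := IH _ (lexx _) S0; set S := \sum_(j <- r) d j in S0 dD * => H.
apply: (@le_trans _ _ (d i `^ e + S `^ e)); first by rewrite lerD2l.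
have pw x : 0 <= x -> x <= D -> x `^ e <= x * D `^ (e - 1).
  by move=> x0 xD; rewrite -mulr_powRB1// ler_wpM2l// ge0_ler_powR ?nnegrE ?subr_ge0.
apply: (@le_trans _ _ (d i * D `^ (e - 1) + S * D `^ (e - 1))).
  by apply: lerD; apply: pw => //; have := d0 i; lra.
by rewrite -mulrDl -[leRHS]mulr_powRB1// ler_wpM2r// powR_ge0.
Qed.

End scales.

(** * Truncations and the estimate on one superlevel set *)

Section truncation.
Context {R : realType} {n : nat}.
Local Notation V := 'rV[R]_n.

Lemma le_poweR (r : R) (x y : \bar R) : 0 <= r -> (0 <= x)%E -> (x <= y)%E ->
  (x `^ r <= y `^ r)%E.
Proof.
move=> r0 x0 xy; apply: gt0_ler_poweR => //; rewrite in_itv/= leey andbT//.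
exact: le_trans xy.
Qed.

Lemma lint_ge0 (D : set V) h : (forall x, D x -> 0 <= h x)%E -> (0 <= lint D h)%E.
Proof. by move=> h0; rewrite lintE; apply: iint_ge0 => l; apply: on_set_ge0. Qed.

Lemma lint_super_sum (I : Type) (r : seq I) (D : set V) (c : I -> R)
  (h : I -> V -> \bar R) (H : V -> \bar R) :
  (forall i, 0 <= c i) -> (forall i x, D x -> 0 <= h i x)%E ->
  (forall x, D x -> \sum_(i <- r) (c i)%:E * h i x <= H x)%E ->
  (\sum_(i <- r) (c i)%:E * lint D (h i) <= lint D H)%E.
Proof.
move=> c0 h0 hH.
have ch0 i l : (0 <= (c i)%:E * on_set D (h i) (rowl n l))%E.
  by rewrite mule_ge0 ?lee_fin// on_set_ge0//; apply: h0.
apply: (@le_trans _ _ (\sum_(i <- r)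
    iint n (fun l => (c i)%:E * on_set D (h i) (rowl n l)))%E).
  by apply: lee_sum => i _; rewrite iintZ// => l; apply: on_set_ge0; apply: h0.
apply: le_trans (iint_super_sum _ _ _ _ ch0) _; rewrite lintE; apply: le_iint => l.
  by apply: sume_ge0.
rewrite /on_set; case: asboolP => [Dx|_]; first exact: hH.
by rewrite big1// => i _; rewrite mule0.
Qed.

Lemma gfun_ge0 (Om : set V) p delta tau u x : (0 <= gfun Om p delta tau u x)%E.
Proof.
by apply: lint_ge0 => y _; rewrite lee_fin divr_ge0 ?powR_ge0.
Qed.

Definition trunc (s : R) (u : V -> R) (x : V) : R := layer s `|u x| / s.

Lemma trunc0 s u x : 0 < s -> u x = 0 -> trunc s u x = 0.
Proof.
move=> s0 ux; rewrite /trunc /layer ux normr0 !min_l ?mulr_ge0 ?(ltW s0)//.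
by rewrite subrr mul0r.
Qed.

Lemma trunc_ge1 s u x : 0 < s -> 2 * s < `|u x| -> 1 <= trunc s u x.
Proof.
move=> s0 ux; rewrite /trunc /layer ler_pdivlMr// mul1r.
by rewrite !min_r; lra.
Qed.

Lemma trunc_continuous (Om : set V) s u : {within Om, continuous u} ->
  {within Om, continuous (trunc s u)}.
Proof.
move=> cu x.
have cn : (fun y : subspace Om => `|u y|) @ x --> `|u x|.
  by apply: continuous_comp; [exact: cu|exact: norm_continuous].
have cm c : (fun y : subspace Om => Num.min `|u y| c) @ x --> Num.min `|u x| c.
  have cn' : {for x, continuous (fun y : subspace Om => `|u y| : R^o)} by exact: cn.
  exact: (continuous_min cn' (cvg_cst (c : R^o))).
have cl : (fun y : subspace Om => layer s `|u y|) @ x --> layer s `|u x|.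
  exact: (cvgB (cm (2 * s)) (cm s)).
have : (fun y : subspace Om => layer s `|u y| / s) @ x --> layer s `|u x| / s.
  exact: (cvgM cl (cvg_cst s^-1)).
exact.
Qed.

Lemma sum_gfun_trunc (Om : set V) p delta tau (u : V -> R) N x : 1 <= p ->
  (\sum_(i < N) (scale i `^ p)%:E * gfun Om p delta tau (trunc (scale i) u) x
   <= gfun Om p delta tau u x)%E.
Proof.
move=> p1; apply: lint_super_sum.
- by move=> i; rewrite powR_ge0.
- by move=> i y _; rewrite lee_fin divr_ge0 ?powR_ge0.
move=> y _; under eq_bigr do rewrite -EFinM mulrA.
rewrite sumEFin lee_fin -mulr_suml ler_wpM2r ?invr_ge0 ?powR_ge0//.
rewrite (eq_bigr (fun i : 'I_N => `|layer (scale i) `|u x| - layer (scale i) `|u y| | `^ p)).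
  apply: sum_powR_le => //.
  apply: le_trans (sum_layer_dist N _ _ (normr_ge0 _) (normr_ge0 _)) _.
  exact: ler_dist_dist.
move=> i _; have s0 := @scale_gt0 R i.
rewrite -powRM ?(ltW s0)// -[X in X * _](gtr0_norm s0) -normrM; congr (`|_| `^ _).
by rewrite /trunc; field; rewrite gt_eqF.
Qed.

Lemma open_superlevel (Om : set V) (u : V -> R) (t : R) :
  open Om -> {within Om, continuous u} -> open (Om `&` [set x | t < `|u x|]).
Proof.
move=> oOm; rewrite continuous_open_subspace// => cu.
rewrite openE => x [Omx /= ux].
have cn : (fun y => `|u y|) @ x --> `|u x|.
  by apply: continuous_comp; [apply: cu; rewrite inE|exact: norm_continuous].
apply: filterI; first exact: open_nbhs_nbhs.
by apply: (cvgr_gt `|u x| cn).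
Qed.

(** The hypothesis is used with [dots E m] as admissible set and [trunc s u] as competitor. The
    bound does not depend on [m], so it passes to [E]. *)
Lemma level_estimate (Om B : set V) (f g : V -> R) (p q delta tau C s : R) (u : V -> R) :
  open Om -> {within Om, continuous f} -> (forall x, Om x -> 0 < f x) ->
  (forall x, Om x -> 0 < g x) -> 0 < p -> 0 < q -> 0 < s -> 0 < C ->
  (forall A : set V, admissible Om A -> A `&` B = set0 ->
     ((lint A (fun x => (f x)%:E)) `^ (p / q) <=
      C%:E * ereal_inf [set e | exists u : V -> R,
           [/\ {within Om, continuous u},
               (forall x, A x -> (1 <= u x)%R),
               (forall x, B x -> u x = 0%R) &
               e = lint Om (fun x => gfun Om p delta tau u x * (g x)%:E)]])%E) ->
  {within Om, continuous u} -> (forall x, B x -> u x = 0) ->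
  (dots_density (R := R) (n := n) %:E * lint (Om `&` [set x | (2 * s < `|u x|)%R]) (EFin \o f) <=
   (C%:E * lint Om (fun x => gfun Om p delta tau (trunc s u) x * (g x)%:E)) `^ (q / p))%E.
Proof.
move=> oOm cf f0 g0 p0 q0 s0 C0 H cu uB.
set E := Om `&` _; set Y := lint Om _.
have EOm : E `<=` Om by move=> x [].
have oE : open E by apply: open_superlevel.
apply: (le_lint_dots Om) => // [x /EOm/f0/ltW //|m].
have dE : dots E m `<=` E := dots_sub E m.
have L0 : (0 <= lint (dots E m) (EFin \o f))%E.
  by apply: lint_ge0 => x /dE/EOm/f0/ltW; rewrite lee_fin.
have Y0 : (0 <= Y)%E.
  by apply: lint_ge0 => x /g0/ltW gx; rewrite mule_ge0 ?gfun_ge0 ?lee_fin.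
have -> : lint (dots E m) (EFin \o f) = (((lint (dots E m) (EFin \o f)) `^ (p / q)) `^ (q / p))%E.
  by rewrite -poweRrM mulf_div [q * p]mulrC mulfV ?poweRe1// gt_eqF ?mulr_gt0.
apply: le_poweR; [by rewrite divr_ge0 ?ltW|exact: poweR_ge0|].
apply: le_trans (H _ (admissible_dots _ _ m oOm EOm) _) _.
  apply/seteqP; split => // x [/dE[_ /= ux] Bx].
  by move: ux; rewrite uB// normr0 ltNge mulr_ge0// ltW.
rewrite lee_pmul2l ?lte_fin//; apply: ereal_inf_lbound.
exists (trunc s u); split => //.
- exact: trunc_continuous.
- by move=> x /dE[_ /= ux]; apply: trunc_ge1.
- by move=> x /uB ux; apply: trunc0.
Qed.

End truncation.

(** * Discrete layer-cake bound *)

Section layer_cake.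
Context {R : realType} {n : nat}.
Local Notation V := 'rV[R]_n.

(** Where [u] is nonzero, one scale satisfies [2 * scale i < |u| <= 4 * scale i], and its term alone
    dominates the integrand. Sum and integral are exchanged by [iint_nneseries], the terms being
    lower semicontinuous. *)
Lemma lint_layers (Om : set V) (f u : V -> R) (q : R) : 0 < q ->
  open Om -> {within Om, continuous f} -> {within Om, continuous u} ->
  (forall x, Om x -> 0 <= f x) ->
  (lint Om (fun x => (`|u x| `^ q * f x)%:E) <=
   \sum_(i <oo) ((4 * scale i) `^ q)%:E *
     lint (Om `&` [set x | (2 * scale i < `|u x|)%R]) (EFin \o f))%E.
Proof.
move=> q0 oOm cf cu f0; pose E i := Om `&` [set x | 2 * scale i < `|u x|].
have h0 i x : (0 <= on_set (E i) (EFin \o f) x)%E.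
  by apply: on_set_ge0 => y [/f0 fy _]; rewrite lee_fin.
have oE i : open (E i) by apply: open_superlevel.
have lE i : lsc (on_set (E i) (EFin \o f)).
  by apply: (lsc_on_set Om) => // x [] //; move=> /f0.
pose G i (_ : unit) (l : seq R) : \bar R :=
  (((4 * scale i) `^ q)%:E * on_set (E i) (EFin \o f) (rowl n l))%E.
have G0 i t l : (0 <= G i t l)%E by rewrite mule_ge0// lee_fin powR_ge0.
have mG i : jmeas n _ unit (G i) by apply: jmeas_scale; apply: jmeas_lsc.
apply: (@le_trans _ _ (iint n (fun l => \sum_(i <oo) G i tt l)%E)); last first.
  rewrite (iint_nneseries n _ unit G tt)//.
  apply: lee_nneseries => i _; first by move=> _; apply: iint_ge0.
  by rewrite /G iintZ ?powR_ge0.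
rewrite lintE; apply: le_iint => l.
  by apply: on_set_ge0 => x /f0 fx; rewrite lee_fin mulr_ge0 ?powR_ge0.
have S0 : (0 <= \sum_(i <oo) G i tt l)%E by apply: nneseries_ge0.
rewrite /on_set; case: asboolP => // Omx; set x := rowl n l in Omx *.
have [ux|ux0] := eqVneq (u x) 0.
  by rewrite ux normr0 powR0 ?gt_eqF// mul0r.
have t0 : 0 < `|u x| / 2 by rewrite divr_gt0// normr_gt0.
have [i /andP[i1 i2]] := scale_bracket _ t0.
have Ei : E i x by split => //=; lra.
apply: (@le_trans _ _ (G i tt l)).
  rewrite /G /on_set asboolT// -EFinM lee_fin ler_wpM2r ?f0//.
  rewrite ge0_ler_powR ?nnegrE ?(ltW q0)//; last lra.
  by rewrite mulr_ge0// ltW// scale_gt0.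
apply: le_trans (nneseries_lim_ge i.+1 _) => //.
by rewrite big_nat_recr//= leeDr// sume_ge0.
Qed.

End layer_cake.

Theorem theorem3p1 (R : realType) (n : nat) (Om : set 'rV[R]_n)
  (f g : 'rV[R]_n -> R) (p q delta tau : R) :
  (2 <= n)%N -> open Om ->
  {within Om, continuous f} -> {within Om, continuous g} ->
  (forall x, Om x -> 0 < f x) -> (forall x, Om x -> 0 < g x) ->
  (lint Om (fun x => (f x)%:E) < +oo)%E ->
  1 <= p -> p <= q -> 0 < delta < 1 -> 0 < tau ->
  (forall B : set 'rV[R]_n, is_eball B -> cpt_in B Om ->
     exists C : R, 0 < C /\
       forall A : set 'rV[R]_n, admissible Om A -> A `&` B = set0 ->
         ((lint A (fun x => (f x)%:E)) `^ (p / q) <=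
          C%:E * ereal_inf [set e | exists u : 'rV[R]_n -> R,
               [/\ {within Om, continuous u},
                   (forall x, A x -> (1 <= u x)%R),
                   (forall x, B x -> u x = 0%R) &
                   e = lint Om (fun x => gfun Om p delta tau u x * (g x)%:E)]])%E) ->
  forall B : set 'rV[R]_n, is_eball B -> cpt_in B Om ->
    exists C : R, 0 < C /\
      forall u : 'rV[R]_n -> R, {within Om, continuous u} ->
        (forall x, B x -> u x = 0) ->
        ((lint Om (fun x => ((`|u x| `^ q) * f x)%:E)) `^ q^-1 <=
         C%:E * (lint Om (fun x => gfun Om p delta tau u x * (g x)%:E)) `^ p^-1)%E.
Proof.
move=> _ oOm cf cg f0 g0 _ p1 pq _ _ H B Bball Bcpt.
have [C [C0 HC]] := H B Bball Bcpt.
have p0 : 0 < p by lra.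
have q0 : 0 < q by lra.
have qp0 : 0 < q / p by rewrite divr_gt0.
have qp1 : 1 <= q / p by rewrite ler_pdivlMr// mul1r.
pose K : R := dots_density (n := n); have K0 : 0 < K := dots_density_gt0.
(* The factors come from the density of the balls, from the 4 in [lint_layers], and from the
   constant of the hypothesis raised to [q / p]. *)
pose C1 := K^-1 * 4 `^ q * C `^ (q / p).
have C10 : 0 < C1 by rewrite !mulr_gt0 ?invr_gt0 ?powR_gt0.
exists (C1 `^ q^-1); split; first exact: powR_gt0.
move=> u cu uB; set X := lint Om (fun x => gfun Om p delta tau u x * _)%E.
pose a i := lint Om (fun x => gfun Om p delta tau (trunc (scale i) u) x * (g x)%:E)%E.
pose b i := lint (Om `&` [set x | (2 * scale i < `|u x|)%R]) (EFin \o f).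
have gg0 v x : Om x -> (0 <= gfun Om p delta tau v x * (g x)%:E)%E.
  by move=> Omx; rewrite mule_ge0 ?gfun_ge0// lee_fin ltW// g0.
have a0 i : (0 <= a i)%E by apply: lint_ge0 => x; apply: gg0.
have X0 : (0 <= X)%E by apply: lint_ge0 => x; apply: gg0.
have sumX N : (\sum_(i < N) (scale i `^ p)%:E * a i <= X)%E.
  apply: lint_super_sum.
  - by move=> i; apply: powR_ge0.
  - by move=> i x; apply: gg0.
  move=> x Omx; under eq_bigr do rewrite muleA.
  rewrite -ge0_sume_distrl; last first.
    by move=> i _; rewrite mule_ge0 ?gfun_ge0// lee_fin powR_ge0.
  by rewrite lee_wpmul2r ?lee_fin ?(ltW (g0 _ Omx))//; apply: sum_gfun_trunc.
(* An infinite energy makes the claim trivial; a finite one makes every [a i] finite, so the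
   remaining computation is in the reals. *)
have [Xy|XNy] := eqVneq X +oo%E.
  by rewrite Xy poweRyr ?invr_eq0 ?gt_eqF// gt0_muley ?leey// lte_fin powR_gt0.
have Xfin : X \is a fin_num by rewrite ge0_fin_numE ?ltey.
have sa i : ((scale i `^ p)%:E * a i <= X)%E.
  apply: le_trans (sumX i.+1); rewrite big_ord_recr/= leeDr// sume_ge0// => j _.
  by rewrite mule_ge0// lee_fin powR_ge0.
have sp0 i : 0 < scale i `^ p :> R by rewrite powR_gt0 ?scale_gt0.
have afin i : a i \is a fin_num.
  rewrite ge0_fin_numE// ltey; apply: contraTneq (sa i) => ->.
  by rewrite gt0_muley ?lte_fin// leye_eq.
have term i : (((4 * scale i) `^ q)%:E * b i <=
    (C1 * (scale i `^ p * fine (a i)) `^ (q / p))%:E)%E.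
  have s0 := @scale_gt0 R i.
  have := level_estimate Om B f g p q delta tau C _ u oOm cf f0 g0 p0 q0 s0 C0 HC cu uB.
  rewrite -/(a i) -/(b i) -/K -(fineK (afin i)) -EFinM poweR_EFin.
  rewrite -lee_pdivlMl// -EFinM => bi.
  have s40 : 0 <= (4 * scale i) `^ q by apply: powR_ge0.
  apply: (le_trans (lee_wpmul2l _ bi)); first by rewrite lee_fin.
  have ai0 : 0 <= fine (a i) by rewrite fine_ge0.
  rewrite -EFinM lee_fin /C1 !powRM ?(ltW s0) ?(ltW C0) ?(ltW (sp0 i))// -powRrM.
  have -> : p * (q / p) = q by field; rewrite gt_eqF.
  rewrite [leLHS](_ : _ = 4 `^ q / K * C `^ (q / p) * (scale i `^ q * fine (a i) `^ (q / p))).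
    by rewrite [4 `^ q / K]mulrC.
  ring.
pose xr := fine X.
have Lx : (lint Om (fun x => ((`|u x| `^ q) * f x)%:E) <= (C1 * xr `^ (q / p))%:E)%E.
  apply: le_trans (lint_layers Om f u q q0 oOm cf cu (fun x Ox => ltW (f0 x Ox))) _.
  have b0 i : (0 <= ((4 * scale i) `^ q)%:E * b i)%E.
    rewrite mule_ge0 ?lee_fin ?powR_ge0//; apply: lint_ge0 => x [/f0 fx _].
    by rewrite lee_fin ltW.
  apply: lime_le; first by apply: is_cvg_nneseries => i _ _; apply: b0.
  apply: nearW => N; rewrite big_mkord.
  apply: (@le_trans _ _ (\sum_(i < N) (C1 * (scale i `^ p * fine (a i)) `^ (q / p))%:E)%E).
    by apply: lee_sum => i _; apply: term.
  rewrite sumEFin lee_fin -mulr_sumr ler_wpM2l ?(ltW C10)//.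
  (* Here [p <= q] enters, through the exponent [q / p >= 1]. *)
  apply: sum_powR_le => //.
    by move=> i; rewrite mulr_ge0 ?fine_ge0// ltW.
  rewrite -lee_fin -sumEFin fineK//; apply: le_trans (sumX N).
  by apply: lee_sum => i _; rewrite EFinM fineK.
have L0 : (0 <= lint Om (fun x => ((`|u x| `^ q) * f x)%:E))%E.
  by apply: lint_ge0 => x /f0 fx; rewrite lee_fin mulr_ge0 ?powR_ge0 ?ltW.
have qi0 : 0 <= q^-1 by rewrite invr_ge0 ltW.
apply: le_trans (le_poweR _ _ _ qi0 L0 Lx) _.
rewrite -(fineK Xfin) !poweR_EFin -EFinM lee_fin powRM ?powR_ge0 ?(ltW C10)//.
by rewrite -powRrM mulrAC mulfV ?gt_eqF// mul1r.
Qed.
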